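(* Let $(\mathbf{X}_1,Y_1),\dots,(\mathbf{X}_N,Y_N),(\mathbf{X},Y)$ be independent and identically distributed. Split the first $N$ pairs into a training set $\mathcal{D}_{\textrm{train}}$ and a calibration set $\mathcal{D}_{\textrm{cal}}$, and split $\mathcal{D}_{\textrm{cal}}$ into two disjoint subsets $\mathcal{D}_{\textrm{cal},1}$ and $\mathcal{D}_{\textrm{cal},2}$. Let $s(\mathbf{x},y)$ be a nonconformity score fitted on $\mathcal{D}_{\textrm{train}}$ (held fixed). Let $\mathcal{F}=\{f(s\mid\mathbf{x},\theta):\theta\in\Theta\}$ be a family of conditional distributions for the score $S=s(\mathbf{X},Y)$ given $\mathbf{X}=\mathbf{x}$, with CDFs $F(s\mid\mathbf{x},\theta)$, equipped with a prior on $\Theta$, and let $\theta^*\in\Theta$ denote the true parameter, i.e. $F(\cdot\mid\mathbf{x},\theta^* )$ is the true conditional CDF of $s(\mathbf{X},Y)$ given $\mathbf{X}=\mathbf{x}$. Set $D=\{(\mathbf{X}_i,s(\mathbf{X}_i,Y_i)):(\mathbf{X}_i,Y_i)\in\mathcal{D}_{\textrm{cal},1}\}$, let $f(\theta\mid D)$ be the posterior, $F(s\mid\mathbf{x},D)=\int F(s\mid\mathbf{x},\theta)f(\theta\mid D)\,d\theta$ the predictive CDF, and $s'(\mathbf{x},y)=F(s(\mathbf{x},y)\mid\mathbf{x},D)$. Let $t_{1-\alpha}$ be the empirical $(1-\alpha)$-quantile of $\{s'(\mathbf{X}_i,Y_i):(\mathbf{X}_i,Y_i)\in\mathcal{D}_{\textrm{cal},2}\}$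 and $R_{\textrm{EPIC}}(\mathbf{x})=\{y:s'(\mathbf{x},y)\le t_{1-\alpha}\}$. Assume that for every $\varepsilon>0$, \[ \lim_{|D|\to\infty}\mathbb{P}\Big(\sup_{s,\mathbf{x}}\big|F(s\mid\mathbf{x},D)-F(s\mid\mathbf{x},\theta^* )\big|>\varepsilon\Big)=0, \] where the probability is over the randomness of $D$. Then \[ \lim_{|\mathcal{D}_{\textrm{cal}}|\to\infty}\mathbb{P}\left(Y\in R_{\textrm{EPIC}}(\mathbf{X})\mid\mathbf{X}=\mathbf{x}\right)=1-\alpha . \]
   Context: $\alpha\in(0,1)$ is the nominal miscoverage level. The limit $|\mathcal{D}_{\textrm{cal}}|\to\infty$ is understood with both $|\mathcal{D}_{\textrm{cal},1}|$ (hence $|D|$) and $|\mathcal{D}_{\textrm{cal},2}|$ tending to infinity. *)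

(* Defs.v *)
From HB Require Import structures.
From mathcomp Require Import all_boot all_order all_algebra.
From mathcomp Require Import all_classical all_reals all_analysis.
Set Implicit Arguments. Unset Strict Implicit. Unset Printing Implicit Defensive.
Import Order.TTheory GRing.Theory Num.Theory.
Import numFieldNormedType.Exports.
Local Open Scope classical_set_scope.
Local Open Scope ring_scope.

(* Mutual independence of a sequence of random elements: the product rule
   for every finite (initial) subfamily and all measurable sets (taking
   A i = setT recovers every finite subfamily). *)
Definition mutually_independent {d} {Om : measurableType d} {R : realType}
  (P : probability Om R) {d'} {U : measurableType d'} (Z : nat -> Om -> U) :=
  forall (n : nat) (A : nat -> set U), (forall i, measurable (A i)) ->
    P (\bigcap_(i in `I_n) (Z i @^-1` A i)) =
    (\big[*%E/1%E]_(i < n) P (Z i @^-1` A i))%E.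

Definition identically_distributed {d} {Om : measurableType d} {R : realType}
  (P : probability Om R) {d'} {U : measurableType d'} (Z : nat -> Om -> U) :=
  forall i (A : set U), measurable A -> P (Z i @^-1` A) = P (Z 0 @^-1` A).

Definition iid {d} {Om : measurableType d} {R : realType}
  (P : probability Om R) {d'} {U : measurableType d'} (Z : nat -> Om -> U) :=
  [/\ forall i, measurable_fun setT (Z i),
      mutually_independent P Z & identically_distributed P Z].

Definition model_cdf {R : realType} {TX Th : Type}
  (f : R -> TX -> Th -> R) (s : R) (x : TX) (th : Th) : R :=
  Rintegral lebesgue_measure `]-oo, s]%classic (fun u => f u x th).

Definition likelihood {R : realType} {TX Th : Type}
  (f : R -> TX -> Th -> R) (D : seq (TX * R)) (th : Th) : R :=
  \prod_(p <- D) f p.2 p.1 th.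

(* posterior predictive CDF
   F(s | x, D) = int F(s | x, th) f(th | D) dth
   with posterior density f(th | D) = prior th * lik D th / int prior * lik D *)
Definition pred_cdf {R : realType} {dT} {Th : measurableType dT}
  (muT : {measure set Th -> \bar R}) (prior : Th -> R) {TX : Type}
  (f : R -> TX -> Th -> R) (D : seq (TX * R)) (s : R) (x : TX) : R :=
  Rintegral muT setT (fun th => model_cdf f s x th * prior th * likelihood f D th)
  / Rintegral muT setT (fun th => prior th * likelihood f D th).

Definition emp_quantile {R : realType} (v : seq R) (beta : R) : R :=
  inf [set t : R | beta <= (count (fun u => u <= t) v)%:R / (size v)%:R].

Section EPIC.
Context {R : realType} {d dX dY dT : measure_display}
  {Om : measurableType d} {TX : measurableType dX} {TY : measurableType dY}
  {Th : measurableType dT}.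
Variables (muT : {measure set Th -> \bar R}) (prior : Th -> R)
  (f : R -> TX -> Th -> R) (sc : TX -> TY -> R)
  (Z : nat -> Om -> TX * TY).

Definition cal1 (n1 : nat) (w : Om) : seq (TX * R) :=
  [seq ((Z i w).1, sc (Z i w).1 (Z i w).2) | i <- iota 0 n1].

Definition sprime (n1 : nat) (w : Om) (x : TX) (y : TY) : R :=
  pred_cdf muT prior f (cal1 n1 w) (sc x y) x.

Definition threshold (alpha : R) (n1 n2 : nat) (w : Om) : R :=
  emp_quantile [seq sprime n1 w (Z i w).1 (Z i w).2 | i <- iota n1 n2]
    (1 - alpha).

Definition epic_region (alpha : R) (n1 n2 : nat) (w : Om) (x : TX) : set TY :=
  [set y | sprime n1 w x y <= threshold alpha n1 n2 w].
End EPIC.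

(* P(Y in R_EPIC(X) | X = x) where, given X = x, the test response Y has the
   conditional law kappa x and is independent of the calibration data:
   the conditional coverage is E_w[ kappa x (R_EPIC(x)(w)) ]. *)
Definition cond_coverage {R : realType} {d dX dY dT : measure_display}
  {Om : measurableType d} {TX : measurableType dX} {TY : measurableType dY}
  {Th : measurableType dT} (P : probability Om R)
  (muT : {measure set Th -> \bar R}) (prior : Th -> R)
  (f : R -> TX -> Th -> R) (sc : TX -> TY -> R) (Z : nat -> Om -> TX * TY)
  (kappa : R.-pker TX ~> TY) (alpha : R) (n1 n2 : nat) (x : TX) : R :=
  fine (\int[P]_w kappa x (epic_region muT prior f sc Z alpha n1 n2 w x))%E.

(* Main.v *)
Require Import Defs.
From HB Require Import structures.
From mathcomp Require Import all_boot all_order all_algebra.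
From mathcomp Require Import all_classical all_reals all_analysis.
From mathcomp Require Import measurable_realfun lra ring.
Set Implicit Arguments. Unset Strict Implicit. Unset Printing Implicit Defensive.
Import Order.TTheory GRing.Theory Num.Theory.
Import numFieldNormedType.Exports.
Import HBNNSimple.
Local Open Scope classical_set_scope.
Local Open Scope ring_scope.

(** Let [U = F(s(X, Y) | X, theta_star)]. Given [X = x] the score has a
    continuous CDF, so [U] is uniform on [0, 1], both conditionally on [X = x]
    and unconditionally. Off the event [bad] that the predictive CDF is more
    than [delta] away from [F(. | ., theta_star)] somewhere, every [s'] is
    within [delta] of the corresponding [U]; the weak law of large numbers for
    the calibration [U]s then puts the empirical quantile within [2 delta] of
    [1 - alpha], and the conditional probability of the region within
    [3 delta] of [1 - alpha].

    [P] carries information only on measurable sets, whereas [bad] is an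
    uncountable union over [x] in an arbitrary measurable space. It is
    nevertheless measurable: it is the preimage, under the map sending the data
    to the likelihood function, of an open set of [L^1(prior)], and a jointly
    measurable function takes its sections in a separable part of [L^1]. *)

(** * Measures with a density *)

Section density.
Local Open Scope ereal_scope.
Context {R : realType} {d} {T : measurableType d}.
Context (mu : {measure set T -> \bar R}) (p : T -> R).
Hypothesis mp : measurable_fun setT p.
Hypothesis p0 : forall x, (0 <= p x)%R.
Hypothesis p1 : \int[mu]_x (p x)%:E = 1.

(** The three proofs are arguments so that the measure and probability instances attach to the term
    itself. *)
Definition density_prob of measurable_fun setT p & (forall x, (0 <= p x)%R)
    & \int[mu]_x (p x)%:E = 1 :=
  fun U : set T => \int[mu]_(x in U) (p x)%:E.

Local Notation nu := (density_prob mp p0 p1).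

Let nu0 : nu set0 = 0.
Proof. by rewrite /density_prob integral_set0. Qed.

Let nu_ge0 U : 0 <= nu U.
Proof. by apply: integral_ge0 => x _; rewrite lee_fin. Qed.

Let nu_sigma_additive : semi_sigma_additive nu.
Proof.
move=> /= F mF tF mUF; rewrite /density_prob; apply: cvg_toP.
  apply: ereal_nondecreasing_is_cvgn => k n kn.
  by apply: lee_sum_nneg_natr => // i _ _; exact: nu_ge0.
rewrite ge0_integral_bigcup//=; first exact/measurable_funTS/measurable_EFinP.
by move=> x _; rewrite lee_fin.
Qed.

HB.instance Definition _ := isMeasure.Build _ _ _ nu
  nu0 nu_ge0 nu_sigma_additive.

HB.instance Definition _ := @Measure_isProbability.Build _ _ R nu p1.

(** The usual ascent: indicators, simple functions by linearity, then monotone convergence under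
    both measures. *)
Lemma integral_density_prob (h : T -> \bar R) :
  measurable_fun setT h -> (forall x, 0 <= h x) ->
  \int[nu]_x h x = \int[mu]_x (h x * (p x)%:E).
Proof.
move=> mh h0.
have indicE (E : set T) : measurable E ->
    (\int[nu]_x (\1_E x)%:E = \int[mu]_x ((\1_E x)%:E * (p x)%:E))%E.
  move=> mE; rewrite integral_indic// setIT [LHS]integral_mkcond.
  apply: eq_integral => x _; rewrite patchE indicE.
  by case: ifP; rewrite (mul1e, mul0e).
have simE (f : {nnsfun T >-> R}) :
    (\int[nu]_x (f x)%:E = \int[mu]_x ((f x)%:E * (p x)%:E))%E.
  under [LHS]eq_integral do rewrite fimfunE -fsumEFin//.
  rewrite [LHS]ge0_integral_fsum//; last 2 first.
  - by move=> r; exact/measurable_EFinP/measurableT_comp.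
  - by move=> n x _; rewrite EFinM nnfun_muleindic_ge0.
  under [RHS]eq_integral.
    move=> x xD; rewrite fimfunE -fsumEFin// ge0_mule_fsuml; last first.
      by move=> r; rewrite EFinM nnfun_muleindic_ge0.
    over.
  rewrite [RHS]ge0_integral_fsum//; last 2 first.
  - move=> r; apply: emeasurable_funM; last exact/measurable_EFinP.
    by apply/measurable_EFinP; do 2 apply/measurableT_comp => //.
  - move=> n x _; apply: mule_ge0; last by rewrite lee_fin.
    by rewrite EFinM nnfun_muleindic_ge0.
  apply: eq_fsbigr => r _.
  (* A negative [r] is not a value of the nonnegative [f]: its preimage is empty and both terms
     vanish. *)
  have [r0|r0] := ltP r 0%R.
    under eq_integral do rewrite preimage_nnfun0// indic0/= mulr0.
    under [RHS]eq_integral do rewrite preimage_nnfun0// indic0/= mulr0 mul0e.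
    by rewrite !integral0.
  rewrite integralZl_indic_nnsfun// indicE//.
  rewrite -ge0_integralZl//.
  - by apply: eq_integral => x _; rewrite [in RHS]EFinM -muleA.
  - apply: emeasurable_funM; last exact/measurable_EFinP.
    exact/measurable_EFinP/measurable_indic.
  - by move=> x _; rewrite mule_ge0 ?lee_fin.
pose f_ := nnsfun_approx measurableT mh.
have cvgf x : (f_ n x)%:E @[n --> \oo] --> h x by exact: cvg_nnsfun_approx.
have ndf x : {homo (fun n => (f_ n x)%:E) : n k / (n <= k)%N >-> (n <= k)%E}.
  by move=> n k nk; rewrite lee_fin; exact/lefP/nd_nnsfun_approx.
have ndp x : {homo (fun n => (f_ n x)%:E * (p x)%:E) :
    n k / (n <= k)%N >-> (n <= k)%E}.
  by move=> n k nk; rewrite lee_wpmul2r ?lee_fin ?p0//; exact: ndf.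
have -> : \int[nu]_x h x = limn (fun n => \int[nu]_x (f_ n x)%:E).
  rewrite -monotone_convergence => [|//| | |]; last 3 first.
  - by move=> n; exact/measurable_EFinP.
  - by move=> n x _; rewrite lee_fin.
  - by move=> x _; exact: ndf.
  by apply: eq_integral => x _; apply/esym/cvg_lim.
under eq_fun do rewrite simE.
rewrite -monotone_convergence => [|//| | |]; last 3 first.
- by move=> n; apply: emeasurable_funM; exact/measurable_EFinP.
- by move=> n x _; rewrite mule_ge0 ?lee_fin.
- by move=> x _; exact: ndp.
apply: eq_integral => x _; apply: cvg_lim => //.
by apply: cvgeZr => //; exact: cvgf.
Qed.

End density.

(** * Separability of the sections of a jointly measurable function *)

Section L1_separability.
Context {R : realType} {d1 d2} {T1 : measurableType d1} {T2 : measurableType d2}.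
Context (nu : probability T2 R).
Implicit Types (g : T1 -> T2 -> R) (f h k : T2 -> R) (S : set T1).

(** Valued in the extended reals, so that it makes sense before integrability is known. *)
Definition L1dist f h : \bar R := (\int[nu]_t `|f t - h t|%:E)%E.

Lemma L1distC f h : L1dist f h = L1dist h f.
Proof. by apply: eq_integral => t _; rewrite distrC. Qed.

Lemma L1distxx f : L1dist f f = 0%E.
Proof. by apply: integral0_eq => t _; rewrite subrr normr0. Qed.

Lemma measurable_L1dist f h : measurable_fun setT f -> measurable_fun setT h ->
  measurable_fun setT (fun t => `|f t - h t|%:E).
Proof.
move=> mf mh; apply/measurable_EFinP/measurableT_comp => //.
exact: measurable_funB.
Qed.

Lemma L1dist_triangle f h k : measurable_fun setT f -> measurable_fun setT h ->
  measurable_fun setT k -> (L1dist f k <= L1dist f h + L1dist h k)%E.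
Proof.
move=> mf mh mk; rewrite /L1dist -ge0_integralD//; try exact: measurable_L1dist.
apply: ge0_le_integral => //; first exact: measurable_L1dist.
  by apply: emeasurable_funD; exact: measurable_L1dist.
by move=> t _; rewrite -EFinD lee_fin ler_distD.
Qed.

Lemma L1distD f f' h h' : measurable_fun setT f -> measurable_fun setT h ->
  measurable_fun setT f' -> measurable_fun setT h' ->
  (L1dist (f \+ f')%R (h \+ h')%R <= L1dist f h + L1dist f' h')%E.
Proof.
move=> mf mh mf' mh'; rewrite /L1dist -ge0_integralD//;
  try exact: measurable_L1dist.
apply: ge0_le_integral => //.
- by apply: measurable_L1dist; exact: measurable_funD.
- by apply: emeasurable_funD; exact: measurable_L1dist.
- move=> t _; rewrite -EFinD lee_fin /= opprD addrACA.
  exact: ler_normD.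
Qed.

Lemma L1distZ c f h : measurable_fun setT f -> measurable_fun setT h ->
  L1dist (fun t => c * f t) (fun t => c * h t) = (`|c|%:E * L1dist f h)%E.
Proof.
move=> mf mh; rewrite /L1dist -ge0_integralZl//; last exact: measurable_L1dist.
by apply: eq_integral => t _; rewrite -mulrBr normrM EFinM.
Qed.

(** The [phi i] need not be sections of [g]. This freedom, with an arbitrary countable index type,
    gives stability under sums (pairs of indices) and under L^1 limits (dependent pairs). *)
Definition L1_separable S g :=
  (forall w, measurable_fun setT (g w)) /\
  exists (I : countType) (phi : I -> T2 -> R),
    (forall i, measurable_fun setT (phi i)) /\
    forall w e, S w -> 0 < e -> exists i, (L1dist (g w) (phi i) < e%:E)%E.

Lemma L1_separable_cst S f : measurable_fun setT f -> L1_separable S (fun=> f).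
Proof.
move=> mf; split=> //; exists unit, (fun=> f); split=> // w e _ e0.
by exists tt; rewrite L1distxx lte_fin.
Qed.

Lemma L1_separableD S g g' : L1_separable S g -> L1_separable S g' ->
  L1_separable S (fun w t => g w t + g' w t).
Proof.
move=> [mg [I [phi [mphi phiP]]]] [mg' [J [psi [mpsi psiP]]]].
split=> [w|]; first exact: measurable_funD.
exists (I * J)%type, (fun ij => phi ij.1 \+ psi ij.2); split=> [ij|w e Sw e0].
  exact: measurable_funD.
have e20 : 0 < e / 2 by rewrite divr_gt0.
have [[i gi] [j gj]] := (phiP w _ Sw e20, psiP w _ Sw e20).
exists (i, j); rewrite (splitr e) EFinD.
by apply: le_lt_trans (lteD gi gj); exact: L1distD.
Qed.

Lemma L1_separableZ S c g : L1_separable S g ->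
  L1_separable S (fun w t => c * g w t).
Proof.
move=> [mg [I [phi [mphi phiP]]]].
split=> [w|]; first exact: measurable_funM.
exists I, (fun i t => c * phi i t); split=> [i|w e Sw e0].
  exact: measurable_funM.
have c0 : 0 < `|c| + 1 by rewrite ltr_wpDl.
have [i gi] := phiP w _ Sw (divr_gt0 e0 c0).
exists i; rewrite L1distZ//.
apply: (@le_lt_trans _ _ ((`|c| + 1)%:E * L1dist (g w) (phi i))%E).
  rewrite lee_wpmul2r ?lee_fin ?lerDl//.
  by apply: integral_ge0 => t _; rewrite lee_fin.
have -> : e%:E = ((`|c| + 1)%:E * (e / (`|c| + 1))%:E)%E.
  by rewrite -EFinM mulrC divfK// gt_eqF.
by rewrite lte_pmul2l ?lte_fin.
Qed.

Lemma L1_separable_sum S (J : Type) (s : seq J) (g : J -> T1 -> T2 -> R) :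
  (forall j, L1_separable S (g j)) ->
  L1_separable S (fun w t => \sum_(j <- s) g j w t).
Proof.
move=> sg; elim: s => [|j s ih].
  under eq_fun do under eq_fun do rewrite big_nil.
  exact: L1_separable_cst.
under eq_fun do under eq_fun do rewrite big_cons.
exact: L1_separableD.
Qed.

(** The union of the countable families of all the [g_ n] works: some [g_ n w] is within [e / 2] of
    [g w], and its own family has a member within [e / 2] of it. *)
Lemma L1_separable_lim S g (g_ : nat -> T1 -> T2 -> R) :
  (forall n, L1_separable S (g_ n)) -> (forall w, measurable_fun setT (g w)) ->
  (forall w, S w -> L1dist (g_ n w) (g w) @[n --> \oo] --> 0%E) ->
  L1_separable S g.
Proof.
move=> sg mg g_g; split=> //.
have [I IP] := choice (fun n => (sg n).2).
pose phi n := sval (cid (IP n)).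
have phiP n := svalP (cid (IP n)).
exists {n & I n}, (fun i => phi (tag i) (tagged i)); split=> [[n i]|w e Sw e0].
  by have [+ _] := phiP n; exact.
have e20 : 0 < e / 2 by rewrite divr_gt0.
have [n gn] : exists n, (L1dist (g_ n w) (g w) < (e / 2)%:E)%E.
  have /fine_cvgP[] := g_g w Sw.
  move=> [n1 _ fn] /cvgrPdist_lt/(_ _ e20)[n2 _ cn].
  exists (maxn n1 n2); rewrite -(fineK (fn _ (leq_maxl _ _))) lte_fin.
  have := cn _ (leq_maxr n1 n2); rewrite sub0r normrN.
  by apply: le_lt_trans; rewrite ler_norm.
have [i gi] := (phiP n).2 w _ Sw e20.
exists (Tagged I i); rewrite (splitr e) EFinD.
apply: le_lt_trans (lteD gn gi); rewrite (L1distC (g_ n w)).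
apply: L1dist_triangle => //; first by have [] := sg n.
by have [+ _] := phiP n; exact.
Qed.

Lemma measurable_indic_pair (A : set (T1 * T2)) w : measurable A ->
  measurable_fun setT (fun t => \1_A (w, t) : R).
Proof.
move=> mA; rewrite (_ : (fun t => _) = \1_(xsection A w)).
  exact/measurable_indic/measurable_xsection.
by apply/funext => t; rewrite !indicE mem_xsection.
Qed.

(** Dynkin induction from rectangles. A rectangle has only two sections, [X2] and the empty set;
    complements are affine images of indicators; a disjoint union is the L^1 limit of its finite
    partial unions by dominated convergence. *)
Lemma L1_separable_indic S (A : set (T1 * T2)) : measurable A ->
  L1_separable S (fun w t => \1_A (w, t)).
Proof.
pose C := [set X `*` Y | X in @measurable _ T1 & Y in @measurable _ T2].
have mE : measurable = <<s C >> by rewrite measurable_prod_measurableType.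
rewrite {1}mE => mA; move: A mA.
apply: (dynkin_induction mE) => [| |X [X1 mX1 [X2 mX2 <-{X}]]|B mB sB|F mF tF sF].
- move=> _ _ [X1 mX1 [X2 mX2 <-]] [Y1 mY1 [Y2 mY2 <-]].
  exists (X1 `&` Y1); first exact: measurableI.
  by exists (X2 `&` Y2); [exact: measurableI|rewrite setXI].
- rewrite (_ : (fun w t => _) = (fun=> cst 1)); first exact: L1_separable_cst.
  by apply/funext => w; apply/funext => t; rewrite indicT.
- split=> [w|]; first by apply: measurable_indic_pair; exact: measurableX.
  exists bool, (fun b => \1_(if b then X2 else set0)); split=> [b|w e _ e0].
    by apply: measurable_indic; case: b.
  exists (w \in X1); rewrite (_ : L1dist _ _ = 0%E) ?lte_fin//.
  apply: integral0_eq => t _; rewrite !indicE in_setX/=.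
  by case: (w \in X1); rewrite ?in_set0/= subrr normr0.
- have -> : (fun w t => \1_(~` B) (w, t) : R) =
      (fun w t => 1 + -1 * \1_B (w, t)).
    apply/funext => w; apply/funext => t; rewrite !indicE in_setC.
    by case: (_ \in _); rewrite ?(mulr0, mulr1, addr0, subrr).
  by apply: L1_separableD; [exact: L1_separable_cst|exact: L1_separableZ].
- pose U n := \big[setU/set0]_(i < n) F i.
  have mU n : measurable (U n) by exact: bigsetU_measurable.
  have mUF : measurable (\bigcup_i F i) by exact: bigcup_measurable.
  apply: (@L1_separable_lim _ _ (fun n w t => \1_(U n) (w, t))).
  + elim=> [|n ihn].
      rewrite (_ : (fun w t => _) = (fun=> cst 0)); first exact: L1_separable_cst.
      by apply/funext => w; apply/funext => t; rewrite /U big_ord0 indic0.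
    have -> : (fun w t => \1_(U n.+1) (w, t) : R) =
        (fun w t => \1_(U n) (w, t) + \1_(F n) (w, t)).
      apply/funext => w; apply/funext => t.
      rewrite {1}/U big_ord_recr/= -/(U n) !indicE in_setU.
      have [wtU|] := boolP ((w, t) \in U n); last by rewrite add0r.
      have [wtF|_] := boolP ((w, t) \in F n); last by rewrite addr0.
      have : (U n `&` F n) (w, t) by split; exact: set_mem.
      by rewrite /U (@trivIset_bigsetUI _ predT)//; apply: sub_trivIset tF.
    exact: L1_separableD.
  + by move=> w; exact: measurable_indic_pair.
  + move=> w Sw.
    have [//|||||_ + _] := @dominated_convergence _ T2 _ nu setT measurableT
      (fun n t => (\1_(U n) (w, t))%:E) (fun t => (\1_(\bigcup_i F i) (w, t))%:E)
      (cst 1%E).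
    * by move=> n; exact/measurable_EFinP/measurable_indic_pair.
    * exact/measurable_EFinP/measurable_indic_pair.
    * apply: aeW => t _; apply: cvg_near_cst.
      have [[i _ Fi]|nF] := pselect ((\bigcup_i F i) (w, t)).
        exists i.+1 => // n /= ni; rewrite !indicE !mem_set//.
          by exists i.
        by rewrite /U -bigcup_mkord; exists i.
      apply: nearW => n; rewrite !indicE !memNset//.
      by rewrite /U -bigcup_mkord => -[i _ Fi]; apply: nF; exists i.
    * exact: finite_measure_integrable_cst.
    * by apply: aeW => t n _; rewrite lee_fin ger0_norm.
    * exact.
Qed.

Lemma measurable_section (g : T1 * T2 -> R) w : measurable_fun setT g ->
  measurable_fun setT (fun t => g (w, t)).
Proof. by move=> mg; exact: (measurableT_comp mg (pair1_measurable w)). Qed.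

Lemma L1_separable_nnsfun S (g : {nnsfun (T1 * T2) >-> R}) :
  L1_separable S (fun w t => g (w, t)).
Proof.
have -> : (fun w t => g (w, t)) = (fun w t =>
    \sum_(y <- finmap.enum_fset (fset_set (range g))) y * \1_(g @^-1` [set y]) (w, t)).
  apply/funext => w; apply/funext => t.
  by rewrite {1}(fimfunE g) (fsbig_finite _ _ (fimfunP g)).
apply: L1_separable_sum => y; apply: L1_separableZ.
exact: L1_separable_indic.
Qed.

(** The simple approximations increase to [g], whose section at [w] in [S] is an integrable
    dominating function, so they converge in L^1. *)
Lemma L1_separable_ge0 S (g : T1 * T2 -> R) : measurable_fun setT g ->
  (forall x, 0 <= g x) ->
  (forall w, S w -> (\int[nu]_t (g (w, t))%:E < +oo)%E) ->
  L1_separable S (fun w t => g (w, t)).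
Proof.
move=> mg g0 ig.
have mEg : measurable_fun setT (EFin \o g) by exact/measurable_EFinP.
pose g_ := nnsfun_approx measurableT mEg.
apply: (@L1_separable_lim _ _ (fun n w t => g_ n (w, t))) => [n|w|w Sw].
- exact: L1_separable_nnsfun.
- exact: measurable_section.
have [//|||||_ + _] := @dominated_convergence _ T2 _ nu setT measurableT
  (fun n t => (g_ n (w, t))%:E) (fun t => (g (w, t))%:E)
  (fun t => (g (w, t))%:E).
- by move=> n; exact/measurable_EFinP/measurable_section.
- exact/measurable_EFinP/measurable_section.
- apply: aeW => t _.
  by apply: (@cvg_nnsfun_approx _ _ _ _ measurableT _ mEg) => // x _; rewrite lee_fin.
- apply/integrableP; split; first exact/measurable_EFinP/measurable_section.
  by under eq_integral do rewrite gee0_abs ?lee_fin//; exact: ig.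
- apply: aeW => t n _; rewrite gee0_abs ?lee_fin//.
  rewrite /g_ nnsfun_approxE -lee_fin.
  by apply: (@le_approx _ _ _ setT (EFin \o g)) => // x _; rewrite lee_fin.
- exact.
Qed.

(** The last hypothesis says that [B] is open in [S] for the L^1 pseudo-distance between sections.
    Separability makes [B] a countable union of balls, each measurable by Tonelli. *)
Lemma measurable_L1_open S (g : T1 * T2 -> R) (B : set T1) :
  measurable S -> measurable_fun setT g -> (forall x, 0 <= g x) ->
  (forall w, S w -> (\int[nu]_t (g (w, t))%:E < +oo)%E) ->
  B `<=` S ->
  (forall w, B w -> exists2 e, 0 < e & forall w', S w' ->
     (L1dist (fun t => g (w, t)) (fun t => g (w', t)) < e%:E)%E -> B w') ->
  measurable B.
Proof.
move=> mS mg g0 ig BS oB.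
have [_ [I [phi [mphi phiP]]]] := L1_separable_ge0 mg g0 ig.
pose ball (j : I * nat) := S `&`
  [set w | (L1dist (fun t => g (w, t)) (phi j.1) < (j.2.+1%:R^-1)%:E)%E].
have mball j : measurable (ball j).
  apply: emeasurable_fun_infty_o => //; apply: measurable_funTS.
  apply: (@measurable_fun_fubini_tonelli_F _ _ _ _ _ nu
    (fun x => `|g x - phi j.1 x.2|%:E)) => [|x]; last by rewrite lee_fin.
  apply/measurable_EFinP/measurableT_comp => //; apply: measurable_funB => //.
  exact: measurableT_comp.
(* Of the countably many balls around the [phi i], those inside [B] cover it. *)
have -> : B = \bigcup_(j in [set j | ball j `<=` B]) ball j.
  apply/seteqP; split=> [w Bw|w [j + bw]]; last exact.
  have [e e0 eB] := oB _ Bw; have Sw := BS _ Bw.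
  have e20 : 0 < e / 2 by rewrite divr_gt0.
  (* Two points of a ball of radius below [e / 2] are less than [e] apart. *)
  have [n _ /(_ n (leqnn n)) ne] := near_infty_natSinv_lt (PosNum e20).
  have [i gi] := phiP w n.+1%:R^-1 Sw ltac:(by rewrite invr_gt0).
  exists (i, n) => // w' [Sw' gi']; apply: eB => //.
  rewrite (splitr e) EFinD.
  have mgw v : measurable_fun setT (fun t => g (v, t)) by exact: measurable_section.
  apply: (le_lt_trans (L1dist_triangle (mgw w) (mphi i) (mgw w'))).
  rewrite (L1distC (phi i)).
  by apply: lteD; [apply: lt_trans gi _|apply: lt_trans gi' _]; rewrite lte_fin.
rewrite bigcup_mkcond; apply: countable_bigcupT_measurable => // j.
by case: ifPn.
Qed.

End L1_separability.

(** * Predictive CDF and measurability of the inconsistency event *)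

Section model.
Context {R : realType} {dX dT} {TX : measurableType dX} {Th : measurableType dT}.
Context (f : R -> TX -> Th -> R).
Hypothesis f0 : forall x th u, 0 <= f u x th.
Hypothesis mf : measurable_fun setT (fun p : R * TX * Th => f p.1.1 p.1.2 p.2).
Hypothesis f1 : forall x th, (\int[lebesgue_measure]_u (f u x th)%:E = 1)%E.
Local Notation leb := (@lebesgue_measure R).

Lemma measurable_density x th : measurable_fun setT (fun u => f u x th).
Proof.
apply: (measurableT_comp mf (g := fun u : R => (u, x, th))).
by apply: measurable_fun_pair => //; apply: measurable_fun_pair.
Qed.

Lemma measurable_EFin_density D x th :
  measurable_fun D (fun u => (f u x th)%:E).
Proof.
by apply: measurable_funTS; apply/measurable_EFinP; exact: measurable_density.
Qed.

Lemma model_cdfE s x th :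
  ((model_cdf f s x th)%:E = \int[leb]_(u in `]-oo, s]) (f u x th)%:E)%E.
Proof.
have mfx := @measurable_EFin_density setT x th.
rewrite /model_cdf /Rintegral fineK// ge0_fin_numE.
  rewrite (@le_lt_trans _ _ 1%E) ?ltry// -(f1 x th).
  by apply: ge0_subset_integral => // u _; rewrite lee_fin.
by apply: integral_ge0 => u _; rewrite lee_fin.
Qed.

Lemma model_cdf_ge0 s x th : 0 <= model_cdf f s x th.
Proof. by apply: Rintegral_ge0. Qed.

Lemma model_cdf_le1 s x th : model_cdf f s x th <= 1.
Proof.
rewrite -lee_fin model_cdfE -(f1 x th); apply: ge0_subset_integral => //.
  exact: measurable_EFin_density.
by move=> u _; rewrite lee_fin.
Qed.

Lemma model_cdf_nd x th : {homo (fun s => model_cdf f s x th) : s t / s <= t}.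
Proof.
move=> s t st; rewrite -lee_fin !model_cdfE; apply: ge0_subset_integral => //.
- exact: measurable_EFin_density.
- by move=> u _; rewrite lee_fin.
- by move=> u /=; rewrite !in_itv/= => /le_trans; exact.
Qed.

(** The CDF is a partial integral of the jointly measurable density truncated to [u <= s], so
    Tonelli applies. *)
Lemma measurable_model_cdf :
  measurable_fun setT (fun p : R * TX * Th => model_cdf f p.1.1 p.1.2 p.2).
Proof.
pose h (q : R * TX * Th * R) : R := if q.2 <= q.1.1.1 then f q.2 q.1.1.2 q.1.2 else 0.
have mh : measurable_fun setT h.
  apply: measurable_fun_ifT => //.
    by apply: measurable_fun_ler => //; do ?apply: measurableT_comp.
  apply: (measurableT_comp mf (g := fun q : R * TX * Th * R => (q.2, q.1.1.2, q.1.2))).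
  by do !apply: measurable_fun_pair => //; do ?apply: measurableT_comp.
have -> : (fun p : R * TX * Th => model_cdf f p.1.1 p.1.2 p.2) =
    fine \o (fubini_F leb (EFin \o h)).
  apply/funext => -[[s x] th] /=; rewrite /model_cdf Rintegral_mkcond.
  congr fine; apply: eq_integral => u _; rewrite /h/= patchE.
  by rewrite mem_setE in_itv/=; case: ifP.
apply: measurableT_comp => //; apply: measurable_fun_fubini_tonelli_F.
  exact/measurable_EFinP.
by move=> q; rewrite lee_fin /h; case: ifP.
Qed.

Lemma measurable_model_cdf_param s x :
  measurable_fun setT (fun th => model_cdf f s x th).
Proof. exact: (measurableT_comp measurable_model_cdf (pair1_measurable (s, x))). Qed.

Lemma measurable_model_cdf_score th :
  measurable_fun setT (fun p : R * TX => model_cdf f p.1 p.2 th).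
Proof.
apply: (measurableT_comp measurable_model_cdf (g := fun p : R * TX => (p, th))).
exact: measurable_fun_pair.
Qed.

Lemma likelihood_ge0 D th : 0 <= likelihood f D th.
Proof. by apply: prodr_ge0. Qed.

Lemma measurable_likelihood D : measurable_fun setT (likelihood f D).
Proof.
rewrite /likelihood; under eq_fun do rewrite big_tnth.
apply: measurable_prod => i _.
exact: (measurableT_comp mf (pair1_measurable (_, _))).
Qed.

Context {dY d} {TY : measurableType dY} {Om : measurableType d}.
Context (sc : TX -> TY -> R) (Z : nat -> Om -> TX * TY).
Hypothesis msc : measurable_fun setT (fun z : TX * TY => sc z.1 z.2).
Hypothesis mZ : forall i, measurable_fun setT (Z i).

Lemma measurable_likelihood_cal1 n : measurable_fun setT
  (fun p : Om * Th => likelihood f (cal1 sc Z n p.1) p.2).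
Proof.
rewrite /likelihood /cal1; under eq_fun do rewrite big_map.
apply: measurable_prod => i _ /=.
have mZ1 : measurable_fun setT (fun p : Om * Th => Z i p.1).
  exact: measurableT_comp.
apply: (measurableT_comp mf (g := fun p : Om * Th =>
  (sc (Z i p.1).1 (Z i p.1).2, (Z i p.1).1, p.2))).
apply: measurable_fun_pair => //; apply: measurable_fun_pair.
  exact: (measurableT_comp msc mZ1).
exact: measurableT_comp.
Qed.

Context (muT : {measure set Th -> \bar R}) (prior : Th -> R).
Hypothesis mprior : measurable_fun setT prior.
Hypothesis prior0 : forall th, 0 <= prior th.
Hypothesis prior1 : (\int[muT]_th (prior th)%:E = 1)%E.

Local Notation pi := (density_prob mprior prior0 prior1).

(** Absorbing the prior into [pi] turns numerator and normalizer into integrals against one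
    probability measure, where the L^1 results apply. *)
Lemma pred_cdfE D s x : pred_cdf muT prior f D s x =
  Rintegral pi setT (fun th => model_cdf f s x th * likelihood f D th) /
  Rintegral pi setT (likelihood f D).
Proof.
have mD := measurable_likelihood D.
have mFD : measurable_fun setT (fun th => model_cdf f s x th * likelihood f D th).
  by apply: measurable_funM => //; exact: measurable_model_cdf_param.
rewrite /pred_cdf /Rintegral !integral_density_prob; [|by apply/measurable_EFinP| |
  by apply/measurable_EFinP|]; last 2 first.
- by move=> th; rewrite lee_fin likelihood_ge0.
- by move=> th; rewrite lee_fin mulr_ge0 ?model_cdf_ge0 ?likelihood_ge0.
congr (fine _ / fine _); apply: eq_integral => th _; rewrite -EFinM; last first.
  by rewrite mulrC.
by rewrite mulrAC.
Qed.

(** A weight in [0, 1] makes the integral 1-Lipschitz for the L^1 distance. The weight will be the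
    model CDF for the numerator and 1 for the normalizer. *)
Lemma Rintegral_L1dist_le (c g g' : Th -> R) :
  measurable_fun setT c -> (forall th, 0 <= c th <= 1) ->
  pi.-integrable setT (EFin \o g) -> pi.-integrable setT (EFin \o g') ->
  `|Rintegral pi setT (fun th => c th * g th) -
    Rintegral pi setT (fun th => c th * g' th)| <= fine (L1dist pi g g').
Proof.
move=> mc c01 ig ig'.
have icg h : pi.-integrable setT (EFin \o h) ->
    pi.-integrable setT (EFin \o (fun th => c th * h th)).
  move=> ih; apply: (le_integrable measurableT _ _ ih).
    apply/measurable_EFinP; apply: measurable_funM => //.
    by apply/measurable_EFinP; exact: measurable_int ih.
  move=> th _ /=; rewrite lee_fin normrM ler_piMl//.
  by have /andP[c0 c1] := c01 th; rewrite ger0_norm.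
rewrite -RintegralB//; [|exact: icg|exact: icg].
have iB : pi.-integrable setT (EFin \o (fun th => c th * g th - c th * g' th)).
  rewrite (_ : _ \o _ = (EFin \o (fun th => (c th * g th)%R)) \-
    (EFin \o (fun th => (c th * g' th)%R)))%E; last exact/funext.
  by apply: integrableB => //; exact: icg.
apply: (le_trans (le_normr_Rintegral measurableT iB)).
have iN : pi.-integrable setT (EFin \o (fun th => `|g th - g' th|)).
  rewrite (_ : _ \o _ = abse \o (EFin \o (fun th => (g th - g' th)%R)))%E//.
  apply: integrable_abse.
  rewrite (_ : _ \o _ = (EFin \o g) \- (EFin \o g'))%E; last exact/funext.
  exact: integrableB.
apply: le_Rintegral => //.
  rewrite (_ : _ \o _ = abse \o
    (EFin \o (fun th => (c th * g th - c th * g' th)%R)))%E//.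
  exact: integrable_abse.
move=> th _; rewrite -mulrBr normrM ler_piMl//.
by have /andP[c0 c1] := c01 th; rewrite ger0_norm.
Qed.

Let lik n (p : Om * Th) := likelihood f (cal1 sc Z n p.1) p.2.

(** The data for which the posterior is well defined. *)
Let S n := [set w | (0 < \int[pi]_th (lik n (w, th))%:E < +oo)%E].

Let mlik n : measurable_fun setT (lik n).
Proof. exact: measurable_likelihood_cal1. Qed.

Let mS n : measurable (S n).
Proof.
have mI : measurable_fun setT (fun w => \int[pi]_th (lik n (w, th))%:E)%E.
  apply: (@measurable_fun_fubini_tonelli_F _ _ _ _ _ pi (EFin \o lik n)).
    by apply/measurable_EFinP; exact: mlik.
  by move=> p; rewrite lee_fin likelihood_ge0.
rewrite (_ : S n = (setT `&` [set w | (0 < \int[pi]_th (lik n (w, th))%:E)%E]) `&`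
  (setT `&` [set w | (\int[pi]_th (lik n (w, th))%:E < +oo)%E])).
  apply: measurableI; first exact: emeasurable_fun_o_infty.
  exact: emeasurable_fun_infty_o.
by rewrite !setTI; apply/seteqP; split=> w /= /andP.
Qed.

(** With denominators cleared, the inequality reads [|N - c * D| - eps * D > 0]. Perturbing [N] and
    [D] by at most [r] lowers the left side by at most [2 * r] in the first term and [eps * r] in
    the second. *)
Lemma ratio_gap_stable (eps c N D N' D' r : R) :
  0 <= eps -> 0 <= c <= 1 -> 0 < D -> 0 < D' -> `|N - N'| <= r -> `|D - D'| <= r ->
  (2 + eps) * r < `|N - c * D| - eps * D ->
  eps < `|N' / D' - c|.
Proof.
move=> e0 /andP[c0 c1] D0 D'0 Nd Dd gap.
have -> : N' / D' - c = (N' - c * D') / D' by field; rewrite gt_eqF.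
rewrite normrM normfV (gtr0_norm D'0) ltr_pdivlMr//.
have h1 : `|N - c * D| <= `|N' - c * D'| + `|N - N'| + `|D - D'|.
  have -> : N - c * D = (N' - c * D') + (N - N') + (- c) * (D - D') by ring.
  apply: (le_trans (ler_normD _ _)); apply: lerD; first exact: ler_normD.
  by rewrite normrM normrN (ger0_norm c0) ler_piMl.
have h2 : eps * D' <= eps * D + eps * r.
  rewrite -mulrDr ler_wpM2l//.
  by move: Dd; rewrite ler_norml => /andP[]; lra.
lra.
Qed.

(** On [S n] the event is open in terms of the likelihood: a pair [(s, x)] witnessing it for [w]
    still witnesses it for nearby likelihoods. Off [S n] the predictive CDF is constant in the data,
    so the event is all of the complement or empty. *)
Lemma measurable_inconsistent thstar n eps : 0 <= eps ->
  measurable [set w | exists (s : R) (x : TX),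
    eps < `| pred_cdf muT prior f (cal1 sc Z n w) s x
             - model_cdf f s x thstar |].
Proof.
move=> eps0.
set B := [set w | _].
rewrite -(setIT B) -(setvU (S n)) setIUr; apply: measurableU; last first.
  apply: (@measurable_L1_open _ _ _ _ _ pi (S n) (lik n)).
  - exact: mS.
  - exact: mlik.
  - by move=> p; exact: likelihood_ge0.
  - by move=> w /andP[].
  - by move=> w [].
  move=> w [[s [x Bw]] Sw].
  pose Dn v := Rintegral pi setT (likelihood f (cal1 sc Z n v)).
  pose Nm v := Rintegral pi setT
    (fun th => model_cdf f s x th * likelihood f (cal1 sc Z n v) th).
  pose G := model_cdf f s x thstar.
  have int_lik v : S n v ->
      pi.-integrable setT (EFin \o likelihood f (cal1 sc Z n v)).
    move=> /andP[_ oo]; apply/integrableP; split.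
      by apply/measurable_EFinP; exact: measurable_likelihood.
    by under eq_integral do rewrite /= ger0_norm ?likelihood_ge0//.
  have Dgt0 v : S n v -> 0 < Dn v by move=> Sv; apply: fine_gt0.
  pose gap := `|Nm w - G * Dn w| - eps * Dn w.
  have gap0 : 0 < gap.
    rewrite subr_gt0 -ltr_pdivlMr ?Dgt0// -{2}(gtr0_norm (Dgt0 _ Sw)) -normf_div.
    rewrite mulrBl mulfK ?gt_eqF ?Dgt0//.
    by move: Bw; rewrite pred_cdfE.
  have eps2 : 0 < 2 + eps by rewrite ltr_wpDr.
  (* The radius at which the [(2 + eps)]-Lipschitz loss of [ratio_gap_stable] stays below the
     gap. *)
  exists (gap / (2 + eps)); first by rewrite divr_gt0.
  move=> v Sv; set dwv := L1dist _ _ _ => dist_lt.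
  have dist0 : (0 <= dwv)%E by apply: integral_ge0 => th _; rewrite lee_fin.
  have dist_fin : dwv \is a fin_num by rewrite ge0_fin_numE// (lt_trans dist_lt)// ltry.
  split=> //; exists s, x; rewrite pred_cdfE.
  apply: (@ratio_gap_stable eps G (Nm w) (Dn w) (Nm v) (Dn v) (fine dwv)) => //.
  - by rewrite model_cdf_ge0 model_cdf_le1.
  - exact: Dgt0.
  - exact: Dgt0.
  - apply: (Rintegral_L1dist_le (measurable_model_cdf_param s x)) => [th| |].
    + by rewrite model_cdf_ge0 model_cdf_le1.
    + exact: int_lik.
    + exact: int_lik.
  - have := @Rintegral_L1dist_le (cst 1) _ _ (measurable_cst _) _
      (int_lik w Sw) (int_lik v Sv).
    under eq_Rintegral do rewrite /= mul1r.
    under [X in _ - X]eq_Rintegral do rewrite /= mul1r.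
    by apply=> th; rewrite ler01 lexx.
  - by rewrite mulrC -ltr_pdivlMr// -lte_fin fineK.
(* Off [S n] the normalizing integral is [0], or [+oo] with [fine +oo = 0]; in
   both cases the junk value of the predictive CDF is [x / 0 = 0]. *)
have pred0 w : ~ S n w -> forall s x, pred_cdf muT prior f (cal1 sc Z n w) s x = 0.
  move=> nSw s x; rewrite pred_cdfE [X in _ / X](_ : _ = 0) ?invr0 ?mulr0//.
  have I0 : (0 <= \int[pi]_th (lik n (w, th))%:E)%E.
    by apply: integral_ge0 => th _; rewrite lee_fin likelihood_ge0.
  rewrite /Rintegral -/(lik n (w, _)); move: I0 nSw; rewrite /S/= /lik/=.
  case: (integral _ _ _) => [r| |]//=; rewrite lee_fin ltry andbT lte_fin.
  by move=> r0 /negP; rewrite -leNgt => r0'; apply/eqP; rewrite eq_le r0 r0'.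
have [Q|nQ] := pselect (exists s x, eps < `|model_cdf f s x thstar|).
  rewrite (_ : _ `&` _ = ~` S n); first by apply: measurableC; exact: mS.
  apply/seteqP; split=> [w []//|w nSw]; split=> //.
  by have [s [x Qsx]] := Q; exists s, x; rewrite pred0// sub0r normrN.
rewrite (_ : _ `&` _ = set0)//; apply/seteqP; split=> // w [[s [x Bsx]] nSw].
by apply: nQ; exists s, x; move: Bsx; rewrite pred0// sub0r normrN.
Qed.
End model.

(** * Probability integral transform *)

(** The point [a] is the supremum of the sublevel set of [p], hence the right end of any flat
    stretch at height [p]. Absence of atoms gives left continuity, so [a] belongs to the set; right
    continuity gives the reverse inequality. *)
Lemma cdf_quantile d (T : measurableType d) (R : realType) (P : probability T R)
    (X : {RV P >-> R}) (p : R) : 0 < p < 1 ->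
  (forall a, P (X @^-1` [set a]) = 0%E) ->
  exists a, cdf X a = p%:E /\ forall s, (cdf X s <= p%:E)%E = (s <= a).
Proof.
move=> /andP[p0 p1] X0.
have ndX := cdf_nondecreasing X.
pose S := [set r | (cdf X r <= p%:E)%E].
have [r0 Sr0] : S !=set0.
  have p0' : (0 < p%:E)%E by rewrite lte_fin.
  have [M [_ MP]] := cvg_cdfNy0 X (open_ereal_lt' p0').
  exists (M - 1); apply/ltW/(MP (M - 1)).
  by rewrite ltrBlDr ltrDl.
have [r1 r1p] : exists r1, (p%:E < cdf X r1)%E.
  have p1' : (p%:E < 1)%E by rewrite lte_fin.
  have [M [_ MP]] := cvg_cdfy1 X (open_ereal_gt' p1').
  by exists (M + 1); apply: (MP (M + 1)); rewrite ltrDl.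
have ubS : ubound S r1.
  move=> r /= Sr; rewrite leNgt; apply/negP => /ltW/ndX r1r.
  by have := lt_le_trans r1p (le_trans r1r Sr); rewrite ltxx.
have supS : has_sup S by split; [exists r0|exists r1].
pose a := sup S.
have Slt r : r < a -> S r.
  move=> /(sup_gt (ex_intro _ r0 Sr0))[s Ss rs].
  by apply: le_trans Ss; apply: ndX; exact: ltW.
have notS r : a < r -> (p%:E < cdf X r)%E.
  move=> ar; rewrite ltNge; apply/negP => Sr.
  by have := sup_upper_bound supS Sr; rewrite leNgt ar.
have cdfa : cdf X a = P (X @^-1` `]-oo, a[).
  have -> : cdf X a = P (X @^-1` (`]-oo, a[ `|` [set a])) by rewrite setUitv1.
  rewrite preimage_setU measureU//; [|exact: measurable_funPTI..|].
    by rewrite [X in (_ + X)%E](X0 a) adde0.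
  apply/seteqP; split=> // t [/= Xt Xa].
  by move: Xt; rewrite Xa in_itv/= ltxx.
have le_a : (cdf X a <= p%:E)%E.
  rewrite cdfa.
  pose F n := X @^-1` `]-oo, a - n.+1%:R^-1].
  have -> : X @^-1` `]-oo, a[ = \bigcup_n F n.
    rewrite -preimage_bigcup; congr (_ @^-1` _).
    apply/seteqP; split=> [t /=|t [n _] /=]; rewrite !in_itv/=; last first.
      by move=> /le_lt_trans; apply; rewrite ltrBlDr ltrDl invr_gt0.
    rewrite -subr_gt0 => ta.
    have [n _ /(_ n (leqnn n)) ne] := near_infty_natSinv_lt (PosNum ta).
    by exists n => //=; rewrite in_itv/= lerBrDl -lerBrDr ltW.
  have cF : P (F n) @[n --> \oo] --> P (\bigcup_n F n).
    apply: nondecreasing_cvg_mu => [n||n m nm].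
    - exact: measurable_funPTI.
    - by apply: bigcup_measurable => n _; exact: measurable_funPTI.
    - apply/subsetPset; apply: preimage_subset; apply: subset_itvl.
      by rewrite bnd_simp lerD2l lerN2 lef_pV2 ?posrE// ler_nat.
  rewrite -(cvg_lim _ cF)//; apply: lime_le; first exact: cvgP cF.
  by apply: nearW => n; apply: Slt; rewrite ltrBlDr ltrDl invr_gt0.
have ge_a : (p%:E <= cdf X a)%E.
  have cX := @cdf_right_continuous _ _ _ _ X a.
  rewrite -(cvg_lim _ cX)//; apply: lime_ge; first exact: cvgP cX.
  by near=> r; apply/ltW/notS; near: r; exact: nbhs_right_gt.
exists a; split; first by apply/eqP; rewrite eq_le le_a.
move=> s; apply/idP/idP => [Ss|/ndX sa]; last exact: le_trans le_a.
exact: sup_upper_bound.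
Unshelve. all: by end_near. Qed.

Section law.
Context {R : realType} {d dX dY dT} {Om : measurableType d}
  {TX : measurableType dX} {TY : measurableType dY} {Th : measurableType dT}.
Context (kappa : R.-pker TX ~> TY) (sc : TX -> TY -> R) (f : R -> TX -> Th -> R)
  (thstar : Th).
Hypothesis msc : measurable_fun setT (fun z : TX * TY => sc z.1 z.2).
Hypothesis f0 : forall x th u, 0 <= f u x th.
Hypothesis mf : measurable_fun setT (fun p : R * TX * Th => f p.1.1 p.1.2 p.2).
Hypothesis f1 : forall x th, (\int[lebesgue_measure]_u (f u x th)%:E = 1)%E.
Hypothesis kappa_cdf : forall (x : TX) (s : R),
  kappa x [set y | sc x y <= s] = ((model_cdf f s x thstar)%:E)%E.

(** The identity as a random variable: under the measure with density [f] its [cdf] is the model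
    CDF. *)
Let idTR : measurableTypeR R -> R := idfun.

#[local] HB.instance Definition _ :=
  @isMeasurableFun.Build _ _ _ _ idTR (@measurable_id _ _ setT).

(** A measure with a Lebesgue density has no atoms, so [cdf_quantile] applies. *)
Lemma model_cdf_quantile x th (p : R) : 0 < p < 1 -> exists a,
  model_cdf f a x th = p /\ forall s, (model_cdf f s x th <= p) = (s <= a).
Proof.
move=> p01.
have mfx : measurable_fun setT (fun u : measurableTypeR R => f u x th).
  exact: measurable_density.
pose nu := density_prob mfx (f0 x th) (f1 x th).
have nuE s : cdf (idTR : {RV nu >-> R}) s = (model_cdf f s x th)%:E.
  by rewrite model_cdfE.
have [a []] := @cdf_quantile _ _ _ nu idTR p p01 (fun a => integral_set1 _ a).
rewrite nuE => -[ap] aP; exists a; split => // s.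
by rewrite -aP nuE lee_fin.
Qed.

(** The event is [sc x y <= a] for the quantile [a], and its mass under [kappa x] is the model CDF
    at [a], that is [p]. *)
Lemma kappa_pit x (p : R) : 0 < p < 1 ->
  kappa x [set y | model_cdf f (sc x y) x thstar <= p] = p%:E.
Proof.
move=> p01; have [a [<- aP]] := model_cdf_quantile x thstar p01.
by rewrite -kappa_cdf; congr (kappa x _); apply/funext => y /=; rewrite aP.
Qed.

Context (P : probability Om R) (Z0 : Om -> TX * TY).
Hypothesis mZ0 : measurable_fun setT Z0.
Hypothesis kappa_law : forall (A : set TX) (B : set TY),
  measurable A -> measurable B ->
  P (Z0 @^-1` (A `*` B)) =
  (\int[P]_(w in Z0 @^-1` (A `*` setT)) kappa (Z0 w).1 B)%E.

Lemma xsectionT (x : TX) : xsection [set: TX * TY] x = setT.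
Proof. by apply/seteqP; split => // y _; rewrite /xsection/= inE. Qed.

(** Dynkin induction from the rectangles of [kappa_law]; sublevel sets of the transformed score are
    not rectangles. *)
Lemma joint_law (C : set (TX * TY)) : measurable C ->
  P (Z0 @^-1` C) = (\int[P]_w kappa (Z0 w).1 (xsection C (Z0 w).1))%E.
Proof.
have mk C' : measurable C' ->
    measurable_fun setT (fun w => kappa (Z0 w).1 (xsection C' (Z0 w).1)).
  move=> mC'; apply: (measurableT_comp
    (@measurable_fun_xsection_finite_kernel _ _ _ _ _ kappa C' _)).
    by rewrite inE.
  exact: measurableT_comp.
have mZC C' : measurable C' -> measurable (Z0 @^-1` C').
  by move=> mC'; rewrite -[_ @^-1` _]setTI; exact: mZ0.
pose G := [set X `*` Y | X in @measurable _ TX & Y in @measurable _ TY].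
have mE : measurable = <<s G >> by rewrite measurable_prod_measurableType.
rewrite {1}mE => mC; move: C mC.
apply: (dynkin_induction mE) => [| |X [X1 mX1 [X2 mX2 <-{X}]]|B mB PB|F mF tF PF].
- move=> _ _ [X1 mX1 [X2 mX2 <-]] [Y1 mY1 [Y2 mY2 <-]].
  exists (X1 `&` Y1); first exact: measurableI.
  by exists (X2 `&` Y2); [exact: measurableI|rewrite setXI].
- rewrite preimage_setT probability_setT.
  under eq_integral do rewrite xsectionT prob_kernel.
  by rewrite integral_cst// mul1e; exact/esym/probability_setT.
- rewrite kappa_law// integral_mkcond; apply: eq_integral => w _.
  rewrite patchE; case: ifPn; rewrite ?inE ?notin_setE/= => wX.
    by rewrite in_xsectionX// inE; case: wX.
  rewrite notin_xsectionX ?measure0//.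
  by rewrite notin_setE => wX1; apply: wX.
- have mCB : measurable (~` B) by exact: measurableC.
  rewrite preimage_setC probability_setC ?PB; last exact: mZC.
  (* The unit mass of the kernel splits over a section and its complement; the finite integral for
     [B] is then cancelled. *)
  have -> : 1%E = (\int[P]_w (kappa (Z0 w).1 (xsection (~` B) (Z0 w).1) +
      kappa (Z0 w).1 (xsection B (Z0 w).1)))%E.
    rewrite -[LHS](probability_setT P) -[LHS]mul1e -integral_cst//.
    apply: eq_integral => w _ /=.
    have -> : xsection (~` B) (Z0 w).1 = ~` xsection B (Z0 w).1.
      by apply/seteqP; split=> y; rewrite /xsection/= !inE.
    have mB' : measurable (xsection B (Z0 w).1) by exact: measurable_xsection.
    have mBC' := measurableC mB'.
    by rewrite -measureU ?setICl// setvU; exact/esym/prob_kernel.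
  rewrite ge0_integralD//; [|exact: mk..].
  by rewrite -PB addeK// fin_num_measure//; exact: mZC.
- have mUF : measurable (\bigcup_k F k) by exact: bigcup_measurable.
  rewrite preimage_bigcup measure_semi_bigcup; [|by move=> n; exact: mZC| |].
  + transitivity (\int[P]_w
        \sum_(n <oo) kappa (Z0 w).1 (xsection (F n) (Z0 w).1))%E; last first.
      apply: eq_integral => w _; rewrite xsection_bigcup measure_semi_bigcup//.
      * by move=> n; exact: measurable_xsection.
      * exact: trivIset_xsection.
      * by apply: bigcup_measurable => n _; exact: measurable_xsection.
    rewrite integral_nneseries//; last by move=> n; exact: mk.
    by apply: eq_eseriesr => n _; exact: PF.
  + by apply/trivIsetP => i j _ _ ij; rewrite -preimage_setI;
      move/trivIsetP: tF => ->//; rewrite preimage_set0.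
  + by rewrite -preimage_bigcup; exact: mZC.
Qed.

Lemma measurable_pit (p : R) :
  measurable [set z | model_cdf f (sc z.1 z.2) z.1 thstar <= p].
Proof.
have mG : measurable_fun setT
    (fun z : TX * TY => model_cdf f (sc z.1 z.2) z.1 thstar).
  apply: (measurableT_comp (measurable_model_cdf_score f0 mf thstar)
    (g := fun z : TX * TY => (sc z.1 z.2, z.1))).
  exact: measurable_fun_pair.
have := mG measurableT _ (measurable_itv `]-oo, p]); rewrite setTI.
by congr measurable; apply/funext => z; rewrite /= in_itv.
Qed.

(** By [kappa_pit] the conditional probability is [p] for every value of the covariate, so averaging
    keeps it. *)
Lemma pit_uniform (p : R) : 0 < p < 1 ->
  P (Z0 @^-1` [set z | model_cdf f (sc z.1 z.2) z.1 thstar <= p]) = p%:E.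
Proof.
move=> p01; rewrite joint_law.
  rewrite -[RHS]mule1 -(probability_setT P) -integral_cst//.
  apply: eq_integral => w _ /=; rewrite -[RHS](kappa_pit (Z0 w).1 p01).
  by congr (kappa _ _); apply/funext => y; rewrite /xsection/= inE.
exact: measurable_pit.
Qed.
End law.

(** * Weak law of large numbers for i.i.d. events *)

Section bounded_expectation.
Context {R : realType} {d} {Om : measurableType d} (P : probability Om R).

(** A class of integrable functions closed under sums and products, which makes linearity of
    expectation free of further side conditions. *)
Definition bounded_rv (X : Om -> R) :=
  measurable_fun setT X /\ exists M, forall w, `|X w| <= M.

Local Notation "''E' X" := (Rintegral P setT X) (at level 10, X at level 8).

Lemma bounded_rv_integrable X : bounded_rv X -> P.-integrable setT (EFin \o X).
Proof.
move=> [mX [M XM]]; apply: measurable_bounded_integrable => //.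
  by rewrite (le_lt_trans (probability_le1 _ _)) ?ltry.
by exists M; split; rewrite ?num_real// => x Mx w _ /=; exact: le_trans (XM w) (ltW Mx).
Qed.

Lemma bounded_rv_cst c : bounded_rv (cst c).
Proof. by split=> //; exists `|c|. Qed.

Lemma bounded_rv_indic (A : set Om) : measurable A -> bounded_rv \1_A.
Proof.
move=> mA; split; first exact: measurable_indic.
by exists 1 => w; rewrite indicE; case: (_ \in _); rewrite ?normr1 ?normr0.
Qed.

Lemma bounded_rvD X Y : bounded_rv X -> bounded_rv Y -> bounded_rv (fun w => X w + Y w).
Proof.
move=> [mX [M XM]] [mY [N YN]]; split; first exact: measurable_funD.
exists (M + N) => w; apply: (le_trans (ler_normD _ _)).
by rewrite lerD.
Qed.

Lemma bounded_rvM X Y : bounded_rv X -> bounded_rv Y -> bounded_rv (fun w => X w * Y w).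
Proof.
move=> [mX [M XM]] [mY [N YN]]; split; first exact: measurable_funM.
by exists (M * N) => w; rewrite normrM ler_pM.
Qed.

Lemma bounded_rv_sum (I : Type) (r : seq I) (X : I -> Om -> R) :
  (forall i, bounded_rv (X i)) -> bounded_rv (fun w => \sum_(i <- r) X i w).
Proof.
move=> bX; elim: r => [|i r ih].
  rewrite (_ : (fun w => _) = cst 0); first exact: bounded_rv_cst.
  by apply/funext => w; rewrite big_nil.
under eq_fun do rewrite big_cons; exact: bounded_rvD.
Qed.

Lemma expectD X Y : bounded_rv X -> bounded_rv Y ->
  'E (fun w => X w + Y w) = 'E X + 'E Y.
Proof. by move=> bX bY; rewrite RintegralD//; exact: bounded_rv_integrable. Qed.

Lemma expectZ c X : bounded_rv X -> 'E (fun w => c * X w) = c * 'E X.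
Proof. by move=> bX; rewrite RintegralZl//; exact: bounded_rv_integrable. Qed.

Lemma expect_cst c : 'E (cst c) = c.
Proof.
rewrite Rintegral_cst// -[RHS]mulr1.
by congr (_ * _); exact: (congr1 fine (probability_setT P)).
Qed.

Lemma expect_indic (A : set Om) : measurable A -> 'E \1_A = fine (P A).
Proof. by move=> mA; rewrite /Rintegral integral_indic// setIT. Qed.

Lemma expect_sum (I : Type) (r : seq I) (X : I -> Om -> R) :
  (forall i, bounded_rv (X i)) ->
  'E (fun w => \sum_(i <- r) X i w) = \sum_(i <- r) 'E (X i).
Proof.
move=> bX; elim: r => [|i r ih].
  rewrite big_nil -[RHS](expect_cst 0); congr Rintegral.
  by apply/funext => w; rewrite big_nil.
under eq_fun do rewrite big_cons; rewrite big_cons -ih expectD//.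
exact: bounded_rv_sum.
Qed.

Lemma expect_le X Y : bounded_rv X -> bounded_rv Y -> (forall w, X w <= Y w) ->
  'E X <= 'E Y.
Proof. by move=> bX bY XY; apply: le_Rintegral => //; exact: bounded_rv_integrable. Qed.

Section weak_lln.
Context (A : nat -> set Om) (p : R).
Hypothesis mA : forall i, measurable (A i).
Hypothesis PA : forall i, P (A i) = p%:E.
Hypothesis PAI : forall i j, i != j -> P (A i `&` A j) = (p * p)%:E.

Let X i w : R := \1_(A i) w - p.

Let bX i : bounded_rv (X i).
Proof. by apply: bounded_rvD; [exact: bounded_rv_indic|exact: bounded_rv_cst]. Qed.

(** Centred indicators of independent events are uncorrelated: the expansion has mean
    [p * p - p * p - p * p + p * p]. *)
Let EXX i j : i != j -> 'E (fun w => X i w * X j w) = 0.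
Proof.
move=> ij.
have mAI : measurable (A i `&` A j) by exact: measurableI.
have bi k := bounded_rv_indic (mA k).
have bZ c Y : bounded_rv Y -> bounded_rv (fun w => c * Y w).
  by move=> bY; exact: (bounded_rvM (bounded_rv_cst c)).
have -> : (fun w => X i w * X j w) = (fun w => \1_(A i `&` A j) w +
    (- p * \1_(A i) w + (- p * \1_(A j) w + p * p))).
  by apply/funext => w; rewrite /X indicI/=; ring.
rewrite expectD; [|exact: bounded_rv_indic|].
  rewrite expectD; [|exact: bZ|apply: bounded_rvD; [exact: bZ|exact: bounded_rv_cst]].
  rewrite expectD; [|exact: bZ|exact: bounded_rv_cst].
  rewrite !(expectZ (- p))//.
  have EA k : 'E (fun w => \1_(A k) w) = p by rewrite [LHS]expect_indic// PA.
  have EAI : 'E (fun w => \1_(A i `&` A j) w) = p * p by rewrite [LHS]expect_indic// PAI.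
  have Ec : 'E (fun=> p * p) = p * p by exact: expect_cst.
  by rewrite EAI !EA Ec; ring.
by do ![apply: bounded_rvD; first exact: bZ]; exact: bounded_rv_cst.
Qed.

Let EXX1 i : 'E (fun w => X i w * X i w) <= 1.
Proof.
rewrite -[leRHS](expect_cst 1); apply: expect_le;
  [exact: bounded_rvM|exact: bounded_rv_cst|].
have /andP[p0 p1] : 0 <= p <= 1.
  by rewrite -!lee_fin -(PA i) measure_ge0 probability_le1.
move=> w; rewrite /X indicE/=; case: (_ \in _) => /=; nra.
Qed.

Lemma measurable_deviation (m n : nat) (e : R) :
  measurable [set w | n%:R * e <= `|\sum_(i <- iota m n) \1_(A i) w - n%:R * p|].
Proof.
have [mS _] : bounded_rv (fun w => \sum_(i <- iota m n) \1_(A i) w - n%:R * p).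
  apply: bounded_rvD; last exact: bounded_rv_cst.
  by apply: bounded_rv_sum => i; exact: bounded_rv_indic.
have mS' : measurable_fun setT
    (fun w => `|\sum_(i <- iota m n) \1_(A i) w - n%:R * p|).
  exact: measurableT_comp.
have := mS' measurableT _ (measurable_itv `[n%:R * e, +oo[); rewrite setTI.
by congr measurable; apply/funext => w; rewrite /= in_itv/= andbT.
Qed.

(** Chebyshev's inequality: cross terms vanish and each square has mean at most 1, so the centred
    sum has second moment at most [n], and [n / (n * e) ^ 2] is the bound. The offset [m] lets the
    sum start after the first calibration set. *)
Lemma weak_lln (m n : nat) (e : R) : (0 < n)%N -> 0 < e ->
  (P [set w | n%:R * e <= `|\sum_(i <- iota m n) \1_(A i) w - n%:R * p|]%R <=
   ((n%:R * e ^+ 2)^-1)%:E)%E.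
Proof.
move=> n0 e0.
pose S w := \sum_(i <- iota m n) X i w.
have SE w : \sum_(i <- iota m n) \1_(A i) w - n%:R * p = S w.
  rewrite /S/X big_split/= sumrN; congr (_ - _).
  by rewrite big_const_seq count_predT size_iota iter_addr_0 mulr_natl.
under eq_set do rewrite SE.
have bS : bounded_rv S by exact: bounded_rv_sum.
have ES2 : 'E (fun w => S w * S w) <= n%:R.
  have -> : (fun w => S w * S w) = (fun w =>
      \sum_(i <- iota m n) \sum_(j <- iota m n) X i w * X j w).
    apply/funext => w; rewrite {1}/S mulr_suml; apply: eq_bigr => i _.
    by rewrite mulr_sumr.
  rewrite expect_sum; last by move=> i; apply: bounded_rv_sum => j; exact: bounded_rvM.
  apply: (@le_trans _ _ (\sum_(i <- iota m n) 1)); last first.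
    by rewrite big_const_seq count_predT size_iota iter_addr_0.
  rewrite [leLHS]big_seq_cond [leRHS]big_seq_cond.
  apply: ler_sum => i /andP[im _].
  rewrite expect_sum; last by move=> j; exact: bounded_rvM.
  rewrite (bigD1_seq i)//= ?iota_uniq// big1 ?addr0//.
  by move=> j ji; rewrite EXX// eq_sym.
have mB : measurable [set w | n%:R * e <= `|S w|].
  by have := measurable_deviation m n e; under eq_set do rewrite SE.
have nn : 0 < n%:R :> R by rewrite ltr0n.
rewrite -[leLHS]fineK ?fin_num_measure// lee_fin -expect_indic//.
have ne : 0 < (n%:R * e) ^+ 2 by rewrite exprn_gt0// mulr_gt0.
have : (n%:R * e) ^+ 2 * 'E \1_[set w | n%:R * e <= `|S w|] <= n%:R.
  apply: le_trans ES2; rewrite -expectZ; last exact: bounded_rv_indic.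
  apply: expect_le; [|exact: bounded_rvM|].
    by apply: (bounded_rvM (bounded_rv_cst _)); exact: bounded_rv_indic.
  move=> w; rewrite indicE -expr2; have [|_] := boolP (_ \in _).
    rewrite inE/= mulr1 => Sw; rewrite -[leRHS]real_normK ?num_real//.
    by rewrite lerXn2r ?nnegrE// mulr_ge0// ltW.
  by rewrite mulr0 sqr_ge0.
rewrite -ler_pdivlMl// => /le_trans; apply.
rewrite [leLHS](_ : _ = (n%:R * e ^+ 2)^-1)//; field.
by rewrite !gt_eqF.
Qed.
End weak_lln.

Lemma iid_events {d'} {U : measurableType d'} (Z : nat -> Om -> U) (A : set U)
    (p : R) : iid P Z -> measurable A -> P (Z 0%N @^-1` A) = p%:E ->
  [/\ forall i, measurable (Z i @^-1` A), forall i, P (Z i @^-1` A) = p%:E &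
     forall i j, i != j -> P (Z i @^-1` A `&` Z j @^-1` A) = (p * p)%:E].
Proof.
move=> [mZ indep ident] mA PA.
have PAi i : P (Z i @^-1` A) = p%:E by rewrite ident.
split=> // [i|i j ij].
  by rewrite -[_ @^-1` _]setTI; exact: mZ.
(* Padding with [setT] extracts independence of a pair from the product rule for an initial
   segment. *)
pose B k := if (k == i) || (k == j) then A else setT.
have mB k : measurable (B k) by rewrite /B; case: ifP.
have i_lt : (i < (maxn i j).+1)%N by rewrite ltnS leq_maxl.
have j_lt : (j < (maxn i j).+1)%N by rewrite ltnS leq_maxr.
have := indep (maxn i j).+1 B mB.
rewrite (bigD1 (Ordinal i_lt))// (bigD1 (Ordinal j_lt))/=; last first.
  by rewrite -val_eqE/= eq_sym.
rewrite {2}/B eqxx {2}/B eqxx orbT !PAi big1 ?mule1; last first.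
  move=> k /andP[ki kj]; rewrite /B -!val_eqE/= in ki kj *.
  by rewrite (negbTE ki) (negbTE kj) preimage_setT probability_setT.
rewrite -EFinM => <-; congr (P _); apply/seteqP; split=> [w [wi wj] k _|w wB].
  by rewrite /B; case: ifPn => [/orP[/eqP ->|/eqP ->]|].
have := wB i i_lt; have := wB j j_lt.
by rewrite /= /B !eqxx orbT.
Qed.
End bounded_expectation.

(** * Quantiles, prediction regions and coverage *)

(** By [hi], the upper bound belongs to the set whose infimum is the quantile; by [lo], no point
    below the lower bound does. The shift by [eps] passes from counts of [u] to counts of [v]. *)
Lemma emp_quantile_close {R : realType} (I : Type) (r : seq I) (u v : I -> R)
    (beta delta eps : R) :
  (0 < size r)%N -> (forall i, `|v i - u i| <= eps) ->
  (size r)%:R * beta <= (count (fun i => u i <= beta + delta) r)%:R ->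
  (count (fun i => u i <= beta - delta) r)%:R < (size r)%:R * beta ->
  beta - delta - eps <= emp_quantile (map v r) beta <= beta + delta + eps.
Proof.
move=> r0 vu hi lo.
have n0 : 0 < (size r)%:R :> R by rewrite ltr0n.
have vuP i : v i <= u i + eps /\ u i <= v i + eps.
  by have := vu i; rewrite ler_norml; split; lra.
rewrite /emp_quantile size_map; set S := [set t | _].
have SE t : S t = ((size r)%:R * beta <= (count (fun i => v i <= t) r)%:R) :> Prop.
  by rewrite /S/= count_map ler_pdivlMr// mulrC.
have Shi : S (beta + delta + eps).
  rewrite SE; apply: (le_trans hi); rewrite ler_nat; apply: sub_count => i /= ui.
  by have [vi _] := vuP i; lra.
have Slo : lbound S (beta - delta - eps).
  move=> t; rewrite SE => St; rewrite leNgt; apply/negP => tlo.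
  have := lt_le_trans lo St; rewrite ltr_nat ltnNge => /negP; apply.
  by apply: sub_count => i /= vi; have [_ ui] := vuP i; lra.
apply/andP; split; first by apply: lb_le_inf => //; exists (beta + delta + eps).
by apply: ge_inf => //; exists (beta - delta - eps).
Qed.

(* The coverage integrand is only sandwiched, never shown to be measurable in
   [w]; the library's [ge0_le_integral] would require that. *)
Lemma ge0_le_integral_nonmeasurable d (T : measurableType d) (R : realType)
    (mu : {measure set T -> \bar R}) (f1 f2 : T -> \bar R) :
  (forall x, 0 <= f1 x)%E -> (forall x, f1 x <= f2 x)%E ->
  (\int[mu]_x f1 x <= \int[mu]_x f2 x)%E.
Proof.
move=> f10 f12; rewrite !ge0_integralTE//; last first.
  by move=> x; exact: le_trans (f12 x).
apply: le_ereal_sup => _ [h hf1 <-]; exists h => // x.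
exact: le_trans (f12 x).
Qed.

(** On [H] the error is at most [c]; off [H] both [g] and [b] lie in [0, 1], which costs at most the
    mass of the complement. *)
Lemma integral_close {R : realType} d (T : measurableType d)
    (P : probability T R) (H : set T) (g : T -> \bar R) (b c : R) :
  measurable H -> (forall w, 0 <= g w <= 1)%E -> 0 <= b - c -> b <= 1 -> 0 <= c ->
  (forall w, H w -> ((b - c)%:E <= g w <= (b + c)%:E)%E) ->
  `|fine (\int[P]_w g w) - b| <= c + fine (P (~` H)).
Proof.
move=> mH g01 bc b1 c0 gH.
have g0 w : (0 <= g w)%E by have /andP[] := g01 w.
have mHC := measurableC mH.
have hi : (\int[P]_w g w <= (b + c)%:E + P (~` H))%E.
  apply: (@le_trans _ _ (\int[P]_w ((b + c)%:E + (\1_(~` H) w)%:E))%E).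
    apply: ge0_le_integral_nonmeasurable => // w.
    rewrite indicE; have [|] := boolP (w \in ~` H).
      move=> _; have /andP[_ g1] := g01 w; apply: (le_trans g1).
      by rewrite -EFinD lee_fin /=; lra.
    rewrite notin_setE/= => /contrapT Hw; rewrite adde0.
    by have /andP[] := gH w Hw.
  rewrite ge0_integralD//; [|by move=> w _; rewrite lee_fin; lra|
    exact/measurable_EFinP/measurable_indic].
  have -> : (\int[P]__ (b + c)%:E = (b + c)%:E)%E.
    by rewrite -[RHS]mule1 -(probability_setT P) -integral_cst.
  by rewrite integral_indic// setIT.
have lo : ((b - c)%:E - P (~` H) <= \int[P]_w g w)%E.
  (* Minorizing by [(b - c)] times the indicator of [H] loses [(b - c)] times the mass of the
     complement, and [b - c] is at most 1. *)
  apply: (@le_trans _ _ (\int[P]_w ((b - c)%:E * (\1_H w)%:E))%E); last first.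
    apply: ge0_le_integral_nonmeasurable => w.
      by rewrite mule_ge0 ?lee_fin.
    rewrite indicE; have [|] := boolP (w \in H); last by rewrite mule0.
    by rewrite inE mule1 => /gH/andP[].
  rewrite ge0_integralZl//; last exact/measurable_EFinP/measurable_indic.
  have h1 : (P H <= 1)%E by exact: probability_le1.
  have h0 : (0 <= P H)%E by exact: measure_ge0.
  have hE : P H = (fine (P H))%:E by rewrite fineK// fin_num_measure.
  have -> : (\int[P]_w (\1_H w)%:E = (fine (P H))%:E)%E.
    by rewrite integral_indic// setIT -hE.
  rewrite (probability_setC P mH).
  by move: h0 h1; rewrite hE -EFinM -!EFinB !lee_fin => h0 h1; nra.
have I_fin : (\int[P]_w g w)%E \is a fin_num.
  rewrite ge0_fin_numE ?integral_ge0//; apply: (le_lt_trans hi).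
  by rewrite lte_add_pinfty ?ltry// ltey_eq fin_num_measure.
have PE : P (~` H) = (fine (P (~` H)))%:E by rewrite fineK// fin_num_measure.
move: hi lo; rewrite PE -(fineK I_fin) -EFinD -EFinB !lee_fin/= => hi lo.
by rewrite ler_norml; apply/andP; split; lra.
Qed.

(** * Monotonicity of the predictive CDF and measurability of the region *)

Section predictive.
Context {R : realType} {dX dT} {TX : measurableType dX} {Th : measurableType dT}.
Context (f : R -> TX -> Th -> R).
Hypothesis f0 : forall x th u, 0 <= f u x th.
Hypothesis mf : measurable_fun setT (fun p : R * TX * Th => f p.1.1 p.1.2 p.2).
Hypothesis f1 : forall x th, (\int[lebesgue_measure]_u (f u x th)%:E = 1)%E.
Context (muT : {measure set Th -> \bar R}) (prior : Th -> R).
Hypothesis mprior : measurable_fun setT prior.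
Hypothesis prior0 : forall th, 0 <= prior th.
Hypothesis prior1 : (\int[muT]_th (prior th)%:E = 1)%E.

Local Notation pi := (density_prob mprior prior0 prior1).

Lemma pred_cdf_nd D x :
  {homo (fun s => pred_cdf muT prior f D s x) : s t / s <= t}.
Proof.
move=> s t st; rewrite !(pred_cdfE f0 mf mprior prior0 prior1).
have mL := measurable_likelihood mf D.
have L0 := likelihood_ge0 f0 D.
(* An infinite normalizer becomes 0 under [fine], with inverse 0, so both values are 0. *)
have [Loo|Lfin] := eqVneq (\int[pi]_th (likelihood f D th)%:E)%E +oo%E.
  by rewrite [in leLHS]/Rintegral [in leRHS]/Rintegral Loo/= invr0 !mulr0.
apply: ler_wpM2r; first by rewrite invr_ge0; apply: Rintegral_ge0 => th _; exact: L0.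
have iL : pi.-integrable setT (EFin \o likelihood f D).
  apply/integrableP; split; first exact/measurable_EFinP.
  by under eq_integral do rewrite /= ger0_norm//; rewrite ltey.
have iFL r : pi.-integrable setT
    (EFin \o (fun th => model_cdf f r x th * likelihood f D th)).
  apply: (le_integrable measurableT _ _ iL).
    apply/measurable_EFinP; apply: measurable_funM => //.
    exact: measurable_model_cdf_param.
  move=> th _ /=; rewrite lee_fin normrM ler_piMl// ger0_norm.
    exact: model_cdf_le1.
  exact: model_cdf_ge0.
apply: le_Rintegral => // th _; rewrite ler_wpM2r//.
exact: model_cdf_nd.
Qed.

Context {dY d} {TY : measurableType dY} {Om : measurableType d}.
Context (sc : TX -> TY -> R) (Z : nat -> Om -> TX * TY).
Hypothesis msc : measurable_fun setT (fun z : TX * TY => sc z.1 z.2).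

Lemma measurable_sublevel_score x (S : set R) : measurable S ->
  measurable [set y | S (sc x y)].
Proof.
move=> mS.
have mscx : measurable_fun setT (sc x).
  exact: (measurableT_comp msc (pair1_measurable x)).
by have := mscx measurableT _ mS; rewrite setTI.
Qed.

(** By monotonicity of the predictive CDF, the region is the preimage under the score of a
    down-closed set of reals, which is an interval. *)
Lemma measurable_epic_region alpha n1 n2 w x :
  measurable (epic_region muT prior f sc Z alpha n1 n2 w x).
Proof.
pose S := [set s | pred_cdf muT prior f (cal1 sc Z n1 w) s x <=
  threshold muT prior f sc Z alpha n1 n2 w].
apply: (@measurable_sublevel_score x S).
apply: is_interval_measurable => s t Ss St r /andP[_ rt].
by apply: le_trans St; exact: pred_cdf_nd.
Qed.
End predictive.

Theorem theorem2 (R : realType) (d dX dY dT : measure_display)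
  (Om : measurableType d) (TX : measurableType dX) (TY : measurableType dY)
  (Th : measurableType dT)
  (P : probability Om R) (Z : nat -> Om -> TX * TY)
  (sc : TX -> TY -> R)
  (f : R -> TX -> Th -> R) (muT : {measure set Th -> \bar R}) (prior : Th -> R)
  (thstar : Th) (kappa : R.-pker TX ~> TY) (alpha : R) :
  0 < alpha < 1 ->
  (* the data (X_i, Y_i) are i.i.d. *)
  iid P Z ->
  (* the (fixed) nonconformity score is measurable *)
  measurable_fun setT (fun z : TX * TY => sc z.1 z.2) ->
  (* kappa is the conditional law of Y given X *)
  (forall (A : set TX) (B : set TY), measurable A -> measurable B ->
     P (Z 0%N @^-1` (A `*` B)) =
     (\int[P]_(w in Z 0%N @^-1` (A `*` setT)) kappa (Z 0%N w).1 B)%E) ->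
  (* each f(. | x, theta) is a probability density of the score *)
  (forall x th u, 0 <= f u x th) ->
  measurable_fun setT (fun p : R * TX * Th => f p.1.1 p.1.2 p.2) ->
  (forall x th, (\int[lebesgue_measure]_u (f u x th)%:E = 1)%E) ->
  (* the prior is a probability density on Theta w.r.t. muT *)
  measurable_fun setT prior ->
  (forall th, 0 <= prior th) ->
  (\int[muT]_th (prior th)%:E = 1)%E ->
  (* theta_star is the true parameter: F(. | x, theta_star) is the true conditional
     CDF of s(X, Y) given X = x *)
  (forall (x : TX) (s : R), kappa x [set y | sc x y <= s] = ((model_cdf f s x thstar)%:E)%E) ->
  (* uniform consistency in probability of the posterior predictive CDF *)
  (forall eps : R, 0 < eps ->
     (fun n : nat => fine (P [set w | exists (s : R) (x : TX),
        eps < `| pred_cdf muT prior f (cal1 sc Z n w) s x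
                 - model_cdf f s x thstar |])) @ \oo --> (0 : R)) ->
  (* conclusion: conditional coverage tends to 1 - alpha as |D_cal,1| and
     |D_cal,2| both tend to infinity *)
  forall x : TX, forall e : R, 0 < e -> exists N : nat, forall n1 n2 : nat,
    (N <= n1)%N -> (N <= n2)%N ->
    `| cond_coverage P muT prior f sc Z kappa alpha n1 n2 x - (1 - alpha) | < e.
Proof.
move=> /andP[alpha0 alpha1] iidZ msc kappa_law f0 mf f1 mprior prior0 prior1
  kappa_cdf consistent x e e0.
pose beta : R := 1 - alpha.
(* So [delta <= e / 8], which bounds the final error, and [delta] is at most a quarter of [beta] and
   of [1 - beta], which keeps [beta - 3 * delta] and [beta + 3 * delta] inside (0, 1). *)
pose delta : R := Num.min (e / 2) (Num.min beta (1 - beta)) / 4.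
have beta0 : 0 < beta by rewrite /beta; lra.
have beta1 : 0 < 1 - beta by rewrite /beta; lra.
have delta0 : 0 < delta by rewrite divr_gt0// !lt_min beta0 beta1 divr_gt0.
have delta_min : delta * 4 <= Num.min (e / 2) (Num.min beta (1 - beta)).
  by rewrite /delta divfK.
move: delta_min; rewrite !le_min => /and3P[delta_e delta_beta delta_1beta].
have mZ i : measurable_fun setT (Z i) by have [] := iidZ.
pose U z := model_cdf f (sc z.1 z.2) z.1 thstar.
pose A p := [set z | U z <= p].
have mA p : measurable (A p) := measurable_pit thstar msc f0 mf p.
have PA p : 0 < p < 1 -> P (Z 0%N @^-1` A p) = p%:E.
  exact: (pit_uniform msc f0 mf f1 kappa_cdf (mZ 0%N) kappa_law).
pose bad n := [set w | exists (s : R) (x : TX),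
  delta < `| pred_cdf muT prior f (cal1 sc Z n w) s x - model_cdf f s x thstar |].
have mbad n : measurable (bad n).
  exact: (measurable_inconsistent f0 mf f1 msc mZ mprior prior0 prior1 _ _ (ltW delta0)).
have e8 : 0 < e / 8 by rewrite divr_gt0.
have [N1 _ N1P] := (cvgrPdist_lt _ _).1 (consistent delta delta0) _ e8.
(* Chosen so that the Chebyshev bound [1 / (n2 * delta ^ 2)] is below [e / 8]. *)
have [N2 _ N2P] : \forall n \near \oo, (n.+1%:R : R)^-1 < e / 8 * delta ^+ 2.
  have ed : 0 < e / 8 * delta ^+ 2 by rewrite mulr_gt0// exprn_gt0.
  exact: (near_infty_natSinv_lt (PosNum ed)).
(* The successor makes [n2] positive and lets [N2P] be used at [n2.-1]. *)
exists (maxn N1 N2.+1) => n1 n2; rewrite !geq_max => /andP[N1n1 _] /andP[_ N2n2].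
have n2_gt0 : (0 < n2)%N by exact: leq_trans N2n2.
have n2R : 0 < n2%:R :> R by rewrite ltr0n.
have Pbad : (P (bad n1) <= (e / 8)%:E)%E.
  rewrite -[P (bad n1)]fineK ?fin_num_measure// lee_fin.
  by have := N1P n1 N1n1; rewrite sub0r normrN ger0_norm ?fine_ge0// => /ltW.
pose dev p := [set w | n2%:R * delta <=
  `|\sum_(i <- iota n1 n2) \1_(Z i @^-1` A p) w - n2%:R * p|].
have mdev p : measurable (dev p).
  apply: measurable_deviation => i.
  by rewrite -[_ @^-1` _]setTI; exact: mZ.
have Pdev p : 0 < p < 1 -> (P (dev p) <= (e / 8)%:E)%E.
  move=> p01; have [mAi PAi PAij] := iid_events iidZ (mA p) (PA p p01).
  apply: (le_trans (weak_lln mAi PAi PAij n1 n2_gt0 delta0)).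
  rewrite lee_fin invfM -ler_pdivlMr ?invr_gt0 ?exprn_gt0// invrK.
  have := N2P n2.-1; rewrite prednK// => N2P'.
  by apply/ltW/N2P'; rewrite /= -ltnS prednK.
(* The good event excludes three events of probability at most [e / 8] each. *)
pose H := ~` (bad n1 `|` (dev (beta + delta) `|` dev (beta - delta))).
have mHC : measurable (bad n1 `|` (dev (beta + delta) `|` dev (beta - delta))).
  by apply: measurableU => //; exact: measurableU.
have mH : measurable H by exact: measurableC.
have PH : fine (P (~` H)) <= e * 3 / 8.
  rewrite setCK -lee_fin fineK ?fin_num_measure//.
  apply: (le_trans (measureU2 _ _ _)) => //; first exact: measurableU.
  have -> : (e * 3 / 8)%:E = ((e / 8)%:E + ((e / 8)%:E + (e / 8)%:E))%E.
    by rewrite -!EFinD; congr EFin; lra.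
  apply: leeD => //; apply: (le_trans (measureU2 _ _ _)) => //.
  by apply: leeD; apply: Pdev; apply/andP; split; lra.
have countE p w : (count (fun i => U (Z i w) <= p) (iota n1 n2))%:R =
    \sum_(i <- iota n1 n2) \1_(Z i @^-1` A p) w :> R.
  elim: (iota n1 n2) => [|i r ih]; first by rewrite big_nil.
  rewrite big_cons /= natrD ih indicE; congr (_%:R + _).
  by congr nat_of_bool; apply/idP/idP; rewrite inE.
have region w : H w ->
    ((beta - 3 * delta)%:E <=
      kappa x (epic_region muT prior f sc Z alpha n1 n2 w x) <=
      (beta + 3 * delta)%:E)%E.
  move=> /not_orP[nbad /not_orP[/negP + /negP]]; rewrite -!ltNge => dev1 dev2.
  have close s x' : `|pred_cdf muT prior f (cal1 sc Z n1 w) s x' -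
      model_cdf f s x' thstar| <= delta.
    by rewrite leNgt; apply/negP => lt; apply: nbad; exists s, x'.
  (* Outside the two deviation events, the [U] values at most [beta + delta] number more than
     [n2 * beta], and those at most [beta - delta] fewer. *)
  have /andP[tlo thi] : beta - delta - delta <=
      threshold muT prior f sc Z alpha n1 n2 w <= beta + delta + delta.
    apply: (@emp_quantile_close _ _ _ (fun i => U (Z i w))).
    - by rewrite size_iota.
    - by move=> i; exact: close.
    - rewrite size_iota countE; move: dev1; rewrite ltr_norml => /andP[+ _].
      by rewrite mulrDr; lra.
    - rewrite size_iota countE; move: dev2; rewrite ltr_norml => /andP[_].
      by rewrite mulrBr; lra.
  have mreg := measurable_epic_region f0 mf f1 mprior prior0 prior1 Z msc alpha n1 n2 w x.
  have mU p : measurable [set y | U (x, y) <= p].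
    have := measurable_xsection x (mA p).
    by congr measurable; apply/funext => y; rewrite /xsection/= inE.
  have kU p : 0 < p < 1 -> kappa x [set y | U (x, y) <= p] = p%:E.
    exact: (kappa_pit f0 mf f1 kappa_cdf).
  have lo01 : 0 < beta - 3 * delta < 1 by apply/andP; split; lra.
  have hi01 : 0 < beta + 3 * delta < 1 by apply/andP; split; lra.
  (* Both bounds become [kappa x]-masses of sublevel sets of [U], between which the region is
     sandwiched: [2 * delta] from the threshold and [delta] from [close]. *)
  rewrite -(kU _ lo01) -(kU _ hi01).
  - apply/andP; split; apply: le_measure; rewrite ?inE//.
    + move=> y /= Uy; rewrite /epic_region/=.
      have := close (sc x y) x; rewrite ler_norml => /andP[_]; rewrite /U/= in Uy.
      by rewrite /sprime; lra.
    + move=> y; rewrite /epic_region/= /sprime => sy.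
      have := close (sc x y) x; rewrite ler_norml => /andP[+ _]; rewrite /U/=.
      by lra.
rewrite /cond_coverage -/beta.
(* Each summand is at most [3 * e / 8]. *)
apply: (@le_lt_trans _ _ (3 * delta + fine (P (~` H)))); last by lra.
apply: integral_close => //; try lra.
move=> w; rewrite measure_ge0/=.
have -> : 1%E = kappa x setT by exact/esym/prob_kernel.
apply: le_measure; rewrite ?inE//.
exact: (measurable_epic_region f0 mf f1 mprior prior0 prior1 Z msc).
Qed.
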